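(* Let $s$ be any integer and $m$ a positive integer, and let $\alpha=(1+\sqrt5)/2$. Then \[ \sum_{j = 1}^\infty \frac{H_m (j)}{j^2 \binom{2j}j}F_{2j + s} = \frac{1}{(2m)!}\left( \frac{\pi }{10} \right)^{2m} \frac{1}{\sqrt 5 }\left((3^{2m} + 1)\alpha ^s - L_s \right), \qquad \sum_{j = 1}^\infty \frac{H_m (j)}{j^2 \binom{2j}j}L_{2j + s} = \frac{1}{(2m)!}\left( \frac{\pi }{10} \right)^{2m} \left((3^{2m} - 1)\alpha ^s + L_s \right). \]
   Context: $F_j$ and $L_j$ denote the Fibonacci and Lucas numbers, defined for all integers $j$ by $F_0=0$, $F_1=1$, $L_0=2$, $L_1=1$, $F_j=F_{j-1}+F_{j-2}$, $L_j=L_{j-1}+L_{j-2}$, extended to negative indices by $F_{-j}=(-1)^{j-1}F_j$, $L_{-j}=(-1)^jL_j$; equivalently $F_j=(\alpha^j-\beta^j)/\sqrt5$, $L_j=\alpha^j+\beta^j$ with $\beta=(1-\sqrt5)/2$. For positive integers $j$, $H_1(j)=1/4$ and, for $m\ge1$, \[ H_{m + 1} (j) = \frac{1}{4}\sum_{n_1 = 1}^{j - 1} \frac{1}{(2n_1 )^2 }\sum_{n_2 = 1}^{n_1 - 1} \frac{1}{(2n_2 )^2 } \cdots \sum_{n_m = 1}^{n_{m - 1} - 1} \frac{1}{(2n_m )^2 }, \] with empty sums equal to zero. *)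

(* Defs.v *)
From Stdlib Require Import Reals ZArith.
From Coquelicot Require Import Coquelicot.

Fixpoint fib (n : nat) : Z :=
  match n with
  | O => 0
  | S k => match k with O => 1 | S l => fib k + fib l end
  end%Z.

Fixpoint luc (n : nat) : Z :=
  match n with
  | O => 2
  | S k => match k with O => 1 | S l => luc k + luc l end
  end%Z.

Definition fibZ (j : Z) : Z :=
  match j with
  | Zneg p => (- 1) ^ (Zpos p - 1) * fib (Pos.to_nat p)
  | _ => fib (Z.to_nat j)
  end%Z.

Definition lucZ (j : Z) : Z :=
  match j with
  | Zneg p => (- 1) ^ Zpos p * luc (Pos.to_nat p)
  | _ => luc (Z.to_nat j)
  end%Z.

Open Scope R_scope.

Definition alpha : R := (1 + sqrt 5) / 2.

(* The m-fold nested sum over  n > n_1 > ... > n_m >= 1  of the products of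
   1 / (2 n_i)^2;  [sum_n_m a 1 (n - 1)] is zero when [n <= 1]. *)
Fixpoint nested_sum (m n : nat) : R :=
  match m with
  | O => 1
  | S k =>
      sum_n_m (fun i : nat => 1 / (2 * INR i) ^ 2 * nested_sum k i) 1 (n - 1)
  end.

(* [H m j] is H_m(j) for m >= 1; the value at m = 0 is junk. *)
Definition H (m j : nat) : R :=
  match m with
  | O => 0
  | S k => 1 / 4 * nested_sum k j
  end.

Definition coeff (m j : nat) : R :=
  H m j / (INR j ^ 2 * Binomial.C (2 * j) j).

(* Main.v *)
Require Import Defs.
From Stdlib Require Import Reals ZArith Lra Lia.
From Coquelicot Require Import Coquelicot.
Open Scope R_scope.

(** If [f(t) = sum_j a_j sin^(2j) t], then [f''(t) = sum_j b_j sin^(2j) t] with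
    [b_j = (2j+2)(2j+1) a_(j+1) - (2j)^2 a_j].  For
    [a_j = 4^j H_m(j) / (j^2 C(2j,j))] the recurrences of the nested sums and of
    the central binomial coefficients identify [b_j] with the coefficients for
    [m - 1].  Integrating twice from [0], one finds that the sum of
    [H_m(j) (2 sin t)^(2j) / (j^2 C(2j,j))] is [t^(2m) / (2m)!] for
    [|t| < PI/2].  Since [2 sin (3 PI / 10)] and [2 sin (- PI / 10)] are the
    golden ratio and its conjugate, Binet's formulas combine these two values
    of [t]. *)

(** * Functions with equal derivatives *)

Section EqOfDeriveEq.

Variables a b c : R.
Hypothesis c_inside : a < c < b.

Lemma eq_of_derive_eq (f g df : R -> R) :
  f c = g c ->
  (forall t, a < t < b -> is_derive f t (df t)) ->
  (forall t, a < t < b -> is_derive g t (df t)) ->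
  forall t, a < t < b -> f t = g t.
Proof.
  intros eq_c derive_f derive_g t t_inside.
  assert (forall u, a < u < b -> is_derive (fun v => f v - g v) u 0)
    as derive_diff.
  { intros u u_inside.
    rewrite <- (Rminus_diag (df u)).
    now apply (is_derive_minus f g); [apply derive_f | apply derive_g]. }
  destruct (Rtotal_order t c) as [t_lt_c | [-> | c_lt_t]]; [| easy |].
  - enough (f t - g t = f c - g c) by lra.
    apply (eq_is_derive (fun v => f v - g v)); [|easy].
    intros u u_between; apply derive_diff; lra.
  - enough (f c - g c = f t - g t) by lra.
    apply (eq_is_derive (fun v => f v - g v)); [|easy].
    intros u u_between; apply derive_diff; lra.
Qed.

Lemma eq_of_derive2_eq (f g df dg d2f : R -> R) :
  f c = g c -> df c = dg c ->
  (forall t, a < t < b -> is_derive f t (df t)) ->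
  (forall t, a < t < b -> is_derive g t (dg t)) ->
  (forall t, a < t < b -> is_derive df t (d2f t)) ->
  (forall t, a < t < b -> is_derive dg t (d2f t)) ->
  forall t, a < t < b -> f t = g t.
Proof.
  intros eq_c deq_c derive_f derive_g derive_df derive_dg.
  apply eq_of_derive_eq with df; try easy.
  intros t t_inside.
  rewrite (eq_of_derive_eq df dg d2f) by easy; now apply derive_g.
Qed.

End EqOfDeriveEq.

(** * Power series in the square of the sine *)

Lemma Rabs_sin_sqr_lt_1 (t : R) :
  - (PI / 2) < t < PI / 2 -> Rabs (sin t ^ 2) < 1.
Proof.
  intros [t_gt t_lt]; rewrite Rabs_pos_eq by apply pow2_ge_0.
  pose proof (cos_gt_0 t t_gt t_lt).
  rewrite <- Rsqr_pow2, sin2; unfold Rsqr; nra.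
Qed.

(* As [(sin^(2n))'' = 2n (2n-1) sin^(2n-2) - (2n)^2 sin^(2n)], these are the
   coefficients of the second derivative of [sum_n a_n sin^(2n)]. *)
Definition PS_sin_sqr_derive2 (a : nat -> R) (n : nat) : R :=
  (2 * INR n + 2) * (2 * INR n + 1) * a (S n) - (2 * INR n) ^ 2 * a n.

Lemma PSeries_sin_sqr_derive2 (a : nat -> R) (x : R) :
  Rbar_lt (Rabs x) (CV_radius a) ->
  PSeries (PS_sin_sqr_derive2 a) x =
  4 * x * (1 - x) * PSeries (PS_derive (PS_derive a)) x
    + 2 * (1 - 2 * x) * PSeries (PS_derive a) x.
Proof.
  intros x_inside; set (da := PS_derive a); set (d2a := PS_derive da).
  assert (ex_pseries da x) as ex_da by now apply ex_pseries_derive.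
  assert (ex_pseries d2a x) as ex_d2a.
  { apply ex_pseries_derive; unfold da; now rewrite CV_radius_derive. }
  assert (ex_pseries (PS_plus da (PS_incr_1 d2a)) x) as ex_sum.
  { now apply ex_pseries_plus; [|apply ex_pseries_incr_1]. }
  assert (ex_pseries (PS_minus d2a (PS_plus da (PS_incr_1 d2a))) x) as ex_diff
    by now apply ex_pseries_minus.
  rewrite (PSeries_ext _ (PS_plus (PS_scal 2 da)
    (PS_scal 4 (PS_incr_1 (PS_minus d2a (PS_plus da (PS_incr_1 d2a))))))).
  - rewrite PSeries_plus, !PSeries_scal, PSeries_incr_1, PSeries_minus,
      PSeries_plus, PSeries_incr_1 by
      auto using ex_pseries_incr_1, ex_pseries_scal, Rmult_comm.
    ring.
  - intros n; unfold PS_sin_sqr_derive2, PS_plus, PS_minus, PS_scal, PS_incr_1,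
      d2a, da, PS_derive, minus, plus, opp, scal, zero; simpl;
      unfold mult; simpl.
    destruct n as [|[|n]]; simpl; ring.
Qed.

Lemma is_derive_PSeries_sin_sqr (a : nat -> R) (t : R) :
  Rbar_lt (Rabs (sin t ^ 2)) (CV_radius a) ->
  is_derive (fun u => PSeries a (sin u ^ 2)) t
    (sin (2 * t) * PSeries (PS_derive a) (sin t ^ 2)).
Proof.
  intros t_inside.
  apply (is_derive_comp (PSeries a) (fun u => sin u ^ 2)).
  - now apply is_derive_PSeries.
  - auto_derive; [easy | rewrite sin_2a; ring].
Qed.

Lemma is_derive2_PSeries_sin_sqr (a : nat -> R) (t : R) :
  Rbar_lt (Rabs (sin t ^ 2)) (CV_radius a) ->
  is_derive (fun u => sin (2 * u) * PSeries (PS_derive a) (sin u ^ 2)) t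
    (PSeries (PS_sin_sqr_derive2 a) (sin t ^ 2)).
Proof.
  intros t_inside.
  assert (is_derive (fun u => sin (2 * u)) t (2 * cos (2 * t))) as derive_sin_2
    by (auto_derive; [easy | ring]).
  pose proof (is_derive_PSeries_sin_sqr (PS_derive a) t) as derive_series.
  rewrite CV_radius_derive in derive_series.
  specialize (derive_series t_inside).
  pose proof (is_derive_mult _ _ t _ _ derive_sin_2 derive_series Rmult_comm)
    as derive_product.
  rewrite PSeries_sin_sqr_derive2 by easy.
  eapply eq_ind; [exact derive_product|].
  assert (cos t ^ 2 = 1 - sin t ^ 2) as cos_sqr
    by (rewrite <- !Rsqr_pow2; apply cos2).
  unfold plus, mult; cbn -[pow PSeries].
  rewrite cos_2a_sin, sin_2a; ring [cos_sqr].
Qed.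

(** * Nested sums *)

Lemma nested_sum_1 (m : nat) : nested_sum (S m) 1 = 0.
Proof.
  apply (sum_n_m_zero (G := R_AbelianMonoid)); lia.
Qed.

Lemma nested_sum_succ (m n : nat) : (1 <= n)%nat ->
  nested_sum (S m) (S n) =
  nested_sum (S m) n + 1 / (2 * INR n) ^ 2 * nested_sum m n.
Proof.
  intros n_ge_1; destruct n as [|n]; [lia|].
  cbn [nested_sum].
  replace (S (S n) - 1)%nat with (S n) by lia.
  replace (S n - 1)%nat with n by lia.
  now rewrite sum_n_Sm by lia.
Qed.

Lemma inv_sqr_double_le_telescoping (x : R) : 1 <= x ->
  1 / (2 * x) ^ 2 <= / x - / (x + 1).
Proof.
  intros x_ge_1; apply Rminus_le_0.
  replace (/ x - / (x + 1) - 1 / (2 * x) ^ 2)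
    with ((3 * x - 1) / (4 * x ^ 2 * (x + 1))) by (field; lra).
  apply Rlt_le, Rdiv_lt_0_compat; nra.
Qed.

Lemma nested_sum_bounds (m n : nat) : (1 <= n)%nat -> 0 <= nested_sum m n <= 1.
Proof.
  revert n; induction m as [|m sum_m_bounds]; intros n n_ge_1; [simpl; lra|].
  enough (0 <= nested_sum (S m) n <= 1 - / INR n) as telescoped.
  { pose proof (Rinv_0_lt_compat (INR n) (lt_0_INR n n_ge_1)); lra. }
  induction n_ge_1 as [|n n_ge_1 IHn].
  { rewrite nested_sum_1; simpl; lra. }
  rewrite nested_sum_succ, S_INR by easy.
  pose proof (le_INR 1 n n_ge_1) as n_ge_1_R; simpl in n_ge_1_R.
  pose proof (inv_sqr_double_le_telescoping (INR n) n_ge_1_R).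
  assert (0 < 1 / (2 * INR n) ^ 2) by (apply Rdiv_lt_0_compat; nra).
  specialize (sum_m_bounds n n_ge_1); nra.
Qed.

(** * The power series of even powers of the arcsine *)

Definition wallis_ratio (j : nat) : R := 4 ^ j / Binomial.C (2 * j) j.

Lemma central_binomial_pos (j : nat) : 0 < Binomial.C (2 * j) j.
Proof.
  unfold Binomial.C; apply Rdiv_lt_0_compat;
    [|apply Rmult_lt_0_compat]; apply INR_fact_lt_0.
Qed.

Lemma central_binomial_succ (j : nat) :
  INR (S j) * Binomial.C (2 * S j) (S j) =
  2 * (2 * INR j + 1) * Binomial.C (2 * j) j.
Proof.
  unfold Binomial.C.
  replace (2 * S j - S j)%nat with (S j) by lia.
  replace (2 * j - j)%nat with j by lia.
  replace (2 * S j)%nat with (S (S (2 * j))) by lia.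
  rewrite !fact_simpl, !mult_INR, !S_INR, mult_INR.
  pose proof (pos_INR j); pose proof (INR_fact_lt_0 j).
  simpl (INR 2); field; lra.
Qed.

Lemma wallis_ratio_0 : wallis_ratio 0 = 1.
Proof. unfold wallis_ratio, Binomial.C; simpl; field. Qed.

Lemma wallis_ratio_pos (j : nat) : 0 < wallis_ratio j.
Proof.
  apply Rdiv_lt_0_compat; [apply pow_lt; lra | apply central_binomial_pos].
Qed.

Lemma wallis_ratio_succ (j : nat) :
  (2 * INR j + 1) * wallis_ratio (S j) = 2 * INR (S j) * wallis_ratio j.
Proof.
  pose proof (central_binomial_pos j); pose proof (central_binomial_pos (S j)).
  pose proof (central_binomial_succ j) as C_succ.
  pose proof (pos_INR j); unfold wallis_ratio; cbn [pow].
  apply Rmult_eq_reg_r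
    with (2 * Binomial.C (2 * j) j * Binomial.C (2 * S j) (S j)); [|nra].
  transitivity (4 * 4 ^ j * (2 * (2 * INR j + 1) * Binomial.C (2 * j) j));
    [field; lra|].
  rewrite <- C_succ; field; lra.
Qed.

Lemma wallis_ratio_le (j : nat) : wallis_ratio j <= 2 * INR j + 1.
Proof.
  induction j as [|j IHj]; [rewrite wallis_ratio_0; simpl; lra|].
  pose proof (wallis_ratio_succ j); pose proof (pos_INR j).
  rewrite S_INR in *; nra.
Qed.

(* The coefficient of [x^(2j)] in [arcsin(x)^(2m) / (2m)!].  For [m > 0] it
   vanishes at [j = 0] because division by [0] gives [0]. *)
Definition arcsin_pow_coeff (m j : nat) : R :=
  match m with
  | O => match j with O => 1 | S _ => 0 end
  | S k => nested_sum k j * (wallis_ratio j / (2 * INR j) ^ 2)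
  end.

Lemma arcsin_pow_coeff_0 (m : nat) : arcsin_pow_coeff (S m) 0 = 0.
Proof.
  unfold arcsin_pow_coeff, Rdiv; simpl (INR 0).
  rewrite Rmult_0_r, pow_i, Rinv_0 by lia; ring.
Qed.

Lemma arcsin_pow_coeff_coeff (m j : nat) : (1 <= m)%nat -> (1 <= j)%nat ->
  arcsin_pow_coeff m j = coeff m j * 4 ^ j.
Proof.
  intros m_ge_1 j_ge_1; destruct m as [|m]; [lia|].
  unfold arcsin_pow_coeff, wallis_ratio, coeff, H.
  pose proof (central_binomial_pos j); pose proof (lt_0_INR j j_ge_1).
  field; lra.
Qed.

Lemma arcsin_pow_coeff_bounded (m j : nat) : Rabs (arcsin_pow_coeff m j) <= 1.
Proof.
  destruct m as [|m].
  { destruct j; simpl; [rewrite Rabs_R1 | rewrite Rabs_R0]; lra. }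
  destruct j as [|j].
  { rewrite arcsin_pow_coeff_0, Rabs_R0; lra. }
  assert (0 <= wallis_ratio (S j) / (2 * INR (S j)) ^ 2 <= 1) as weight_bounds.
  { pose proof (wallis_ratio_pos (S j)); pose proof (wallis_ratio_le (S j)).
    pose proof (pos_INR j); rewrite S_INR in *; split.
    - apply Rlt_le, Rdiv_lt_0_compat; nra.
    - apply Rle_div_l; nra. }
  pose proof (nested_sum_bounds m (S j) ltac:(lia)) as sum_bounds.
  unfold arcsin_pow_coeff; rewrite Rabs_pos_eq; nra.
Qed.

Lemma PS_sin_sqr_derive2_arcsin_pow_coeff (m n : nat) :
  PS_sin_sqr_derive2 (arcsin_pow_coeff (S m)) n = arcsin_pow_coeff m n.
Proof.
  assert ((2 * INR n + 2) * (2 * INR n + 1) * arcsin_pow_coeff (S m) (S n)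
          = nested_sum m (S n) * wallis_ratio n) as leading_term.
  { unfold arcsin_pow_coeff.
    pose proof (lt_0_INR (S n) ltac:(lia)).
    transitivity (nested_sum m (S n) *
      ((2 * INR n + 1) * wallis_ratio (S n)) / (2 * INR (S n))).
    - rewrite S_INR in *; field; lra.
    - rewrite wallis_ratio_succ; field; lra. }
  unfold PS_sin_sqr_derive2; rewrite leading_term.
  destruct n as [|n].
  { rewrite wallis_ratio_0, arcsin_pow_coeff_0; destruct m as [|m].
    - simpl; ring.
    - rewrite nested_sum_1, arcsin_pow_coeff_0; ring. }
  pose proof (lt_0_INR (S n) ltac:(lia)).
  unfold arcsin_pow_coeff; destruct m as [|m].
  - cbn [nested_sum]; field; lra.
  - rewrite nested_sum_succ by lia; field; lra.
Qed.

Lemma CV_radius_ge_1_of_bounded (a : nat -> R) (M : R) :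
  (forall n, Rabs (a n) <= M) -> Rbar_le 1 (CV_radius a).
Proof.
  intros a_bounded; apply (proj1 (CV_radius_bounded a)).
  exists M; intros n; rewrite pow1, Rmult_1_r; apply a_bounded.
Qed.

Lemma sin_sqr_inside_arcsin_pow_coeff (m : nat) (t : R) :
  - (PI / 2) < t < PI / 2 ->
  Rbar_lt (Rabs (sin t ^ 2)) (CV_radius (arcsin_pow_coeff m)).
Proof.
  intros t_inside; apply Rbar_lt_le_trans with 1.
  - now apply Rabs_sin_sqr_lt_1.
  - apply CV_radius_ge_1_of_bounded with 1, arcsin_pow_coeff_bounded.
Qed.

Lemma is_derive_pow_fact (n : nat) (t : R) :
  is_derive (fun u => u ^ S n / INR (fact (S n))) t (t ^ n / INR (fact n)).
Proof.
  pose proof (INR_fact_neq_0 n); pose proof (not_0_INR (S n) ltac:(lia)).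
  apply (is_derive_ext (fun u => / INR (fact (S n)) * u ^ S n));
    [intros u; apply Rmult_comm|].
  replace (t ^ n / INR (fact n))
    with (/ INR (fact (S n)) * (INR (S n) * 1 * t ^ pred (S n)))
    by (rewrite fact_simpl, mult_INR; simpl pred; field; lra).
  apply is_derive_scal, (is_derive_pow (fun u => u)).
  apply (is_derive_id (K := R_AbsRing)).
Qed.

Lemma PSeries_arcsin_pow_coeff (m : nat) (t : R) : - (PI / 2) < t < PI / 2 ->
  PSeries (arcsin_pow_coeff m) (sin t ^ 2) = t ^ (2 * m) / INR (fact (2 * m)).
Proof.
  revert t; induction m as [|m IHm].
  { intros t t_inside; rewrite PSeries_decr_1.
    - rewrite (PSeries_ext _ (fun _ => 0)) by easy.
      rewrite PSeries_const_0; simpl; field.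
    - now apply CV_radius_inside, sin_sqr_inside_arcsin_pow_coeff. }
  replace (2 * S m)%nat with (S (S (2 * m))) by lia.
  pose proof PI_RGT_0.
  apply eq_of_derive2_eq with (c := 0)
    (df := fun t => sin (2 * t) *
             PSeries (PS_derive (arcsin_pow_coeff (S m))) (sin t ^ 2))
    (dg := fun t => t ^ S (2 * m) / INR (fact (S (2 * m))))
    (d2f := fun t => t ^ (2 * m) / INR (fact (2 * m))).
  - lra.
  - rewrite sin_0, !pow_i, PSeries_0, arcsin_pow_coeff_0 by lia.
    unfold Rdiv; ring.
  - rewrite Rmult_0_r, sin_0, !pow_i by lia; unfold Rdiv; ring.
  - intros t t_inside.
    now apply is_derive_PSeries_sin_sqr, sin_sqr_inside_arcsin_pow_coeff.
  - intros t _; apply is_derive_pow_fact.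
  - intros t t_inside; rewrite <- IHm by easy.
    rewrite <- (PSeries_ext _ _ _ (PS_sin_sqr_derive2_arcsin_pow_coeff m)).
    now apply is_derive2_PSeries_sin_sqr, sin_sqr_inside_arcsin_pow_coeff.
  - intros t _; apply is_derive_pow_fact.
Qed.

Lemma is_series_coeff_sin (m : nat) (t : R) :
  (1 <= m)%nat -> - (PI / 2) < t < PI / 2 ->
  is_series (fun n => coeff m (S n) * (2 * sin t) ^ (2 * S n))
    (t ^ (2 * m) / INR (fact (2 * m))).
Proof.
  intros m_ge_1 t_inside.
  rewrite <- PSeries_arcsin_pow_coeff by easy.
  assert (is_series (fun n => arcsin_pow_coeff m n * (sin t ^ 2) ^ n)
            (PSeries (arcsin_pow_coeff m) (sin t ^ 2))) as full_series.
  { apply is_pseries_R, PSeries_correct, CV_radius_inside.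
    now apply sin_sqr_inside_arcsin_pow_coeff. }
  apply (is_series_ext (fun n => arcsin_pow_coeff m (S n) * (sin t ^ 2) ^ S n)).
  - intros n; rewrite arcsin_pow_coeff_coeff by lia.
    rewrite (pow_mult (2 * sin t)), Rmult_assoc, <- Rpow_mult_distr.
    do 2 f_equal; ring.
  - apply (is_series_incr_1 (fun n => arcsin_pow_coeff m n * (sin t ^ 2) ^ n)).
    destruct m as [|m]; [lia|].
    rewrite arcsin_pow_coeff_0, Rmult_0_l.
    now rewrite (plus_zero_r (G := R_AbelianMonoid)).
Qed.

(** * Binet's formulas *)

Definition beta : R := (1 - sqrt 5) / 2.

Lemma sqrt5_sqr : sqrt 5 * sqrt 5 = 5.
Proof. apply sqrt_sqrt; lra. Qed.

Lemma sqrt5_gt_1 : 1 < sqrt 5.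
Proof. pose proof (sqrt_pos 5); pose proof sqrt5_sqr; nra. Qed.

Lemma alpha_sqr : alpha * alpha = alpha + 1.
Proof. unfold alpha; pose proof sqrt5_sqr; nra. Qed.

Lemma beta_sqr : beta * beta = beta + 1.
Proof. unfold beta; pose proof sqrt5_sqr; nra. Qed.

Lemma alpha_neq_0 : alpha <> 0.
Proof. unfold alpha; pose proof sqrt5_gt_1; lra. Qed.

Lemma beta_neq_0 : beta <> 0.
Proof. unfold beta; pose proof sqrt5_gt_1; lra. Qed.

Lemma inv_alpha : / alpha = - beta.
Proof.
  apply Rmult_eq_reg_l with alpha; [|apply alpha_neq_0].
  rewrite Rinv_r by apply alpha_neq_0.
  unfold alpha, beta; pose proof sqrt5_sqr; nra.
Qed.

Lemma inv_beta : / beta = - alpha.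
Proof.
  rewrite <- (Ropp_involutive beta), <- inv_alpha, Rinv_opp, Rinv_inv; ring.
Qed.

Definition binet_form (p q : R) (j : Z) : R :=
  p * powerRZ alpha j + q * powerRZ beta j.

Lemma binet_form_succ_succ (p q : R) (j : Z) :
  binet_form p q (j + 2) = binet_form p q (j + 1) + binet_form p q j.
Proof.
  unfold binet_form.
  rewrite !powerRZ_add by (apply alpha_neq_0 || apply beta_neq_0); simpl.
  rewrite !Rmult_1_r, alpha_sqr, beta_sqr; ring.
Qed.

Lemma binet_form_opp (p q : R) (n : nat) :
  binet_form p q (- Z.of_nat n) = (-1) ^ n * binet_form q p (Z.of_nat n).
Proof.
  assert (forall x, powerRZ (- x) (Z.of_nat n) = (-1) ^ n * x ^ n)
    as powerRZ_opp.
  { intros x; rewrite <- pow_powerRZ, <- Rpow_mult_distr; f_equal; ring. }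
  unfold binet_form.
  rewrite !powerRZ_neg', <- !powerRZ_inv', inv_alpha, inv_beta, !powerRZ_opp.
  rewrite <- !pow_powerRZ; ring.
Qed.

Lemma binet_form_of_recurrence (u : nat -> Z) (p q : R) :
  (forall n, u (S (S n)) = (u (S n) + u n)%Z) ->
  IZR (u 0%nat) = binet_form p q 0 -> IZR (u 1%nat) = binet_form p q 1 ->
  forall n, IZR (u n) = binet_form p q (Z.of_nat n).
Proof.
  intros u_rec u_0 u_1 n.
  enough (IZR (u n) = binet_form p q (Z.of_nat n) /\
    IZR (u (S n)) = binet_form p q (Z.of_nat n + 1)) by easy.
  induction n as [|n [u_n u_Sn]]; [easy|].
  rewrite u_rec, plus_IZR, u_n, u_Sn, Nat2Z.inj_succ; unfold Z.succ.
  split; [easy|].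
  rewrite <- Z.add_assoc, binet_form_succ_succ; ring.
Qed.

Lemma fib_binet (n : nat) :
  IZR (fib n) = binet_form (/ sqrt 5) (- / sqrt 5) (Z.of_nat n).
Proof.
  pose proof sqrt5_gt_1.
  apply binet_form_of_recurrence; [easy | |]; unfold binet_form; simpl.
  - ring.
  - unfold alpha, beta; field; lra.
Qed.

Lemma luc_binet (n : nat) : IZR (luc n) = binet_form 1 1 (Z.of_nat n).
Proof.
  apply binet_form_of_recurrence; [easy | |]; unfold binet_form; simpl.
  - ring.
  - unfold alpha, beta; field.
Qed.

Lemma fibZ_binet (j : Z) : IZR (fibZ j) = binet_form (/ sqrt 5) (- / sqrt 5) j.
Proof.
  destruct j as [|p|p].
  - apply (fib_binet 0).
  - rewrite <- (positive_nat_Z p) at 2; apply fib_binet.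
  - unfold fibZ; rewrite <- (Pos2Z.opp_pos p), <- (positive_nat_Z p).
    destruct (Pos2Nat.is_succ p) as [n ->].
    replace (Z.of_nat (S n) - 1)%Z with (Z.of_nat n) by lia.
    rewrite mult_IZR, fib_binet, binet_form_opp, <- pow_IZR.
    unfold binet_form; simpl pow; ring.
Qed.

Lemma lucZ_binet (j : Z) : IZR (lucZ j) = binet_form 1 1 j.
Proof.
  destruct j as [|p|p].
  - apply (luc_binet 0).
  - rewrite <- (positive_nat_Z p) at 2; apply luc_binet.
  - unfold lucZ; rewrite <- (Pos2Z.opp_pos p), <- (positive_nat_Z p).
    now rewrite mult_IZR, luc_binet, binet_form_opp, <- pow_IZR.
Qed.

(** * The golden angles *)

(* [cos 3a = sin 2a] at [a = PI / 10] is a quadratic equation for [sin a]. *)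
Lemma sin_opp_PI_10 : 2 * sin (- (PI / 10)) = beta.
Proof.
  pose proof PI_RGT_0.
  set (a := PI / 10).
  assert (0 < cos a) as cos_pos by (apply cos_gt_0; unfold a; lra).
  assert (0 < sin a) as sin_pos by (apply sin_gt_0; unfold a; lra).
  assert (cos (2 * a + a) = sin (2 * a)) as complementary.
  { rewrite <- cos_shift; f_equal; unfold a; field. }
  rewrite cos_plus, cos_2a_sin, sin_2a in complementary.
  assert (4 * sin a * sin a + 2 * sin a - 1 = 0) as quadratic.
  { apply Rmult_eq_reg_l with (cos a); nra. }
  rewrite sin_neg; unfold beta; pose proof sqrt5_sqr; pose proof sqrt5_gt_1.
  assert ((4 * sin a + 1 - sqrt 5) * (4 * sin a + 1 + sqrt 5) = 0) as factored
    by nra.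
  apply Rmult_integral in factored; destruct factored; lra.
Qed.

Lemma sin_3_PI_10 : 2 * sin (3 * (PI / 10)) = alpha.
Proof.
  replace (3 * (PI / 10)) with (PI / 2 - 2 * (PI / 10)) by field.
  rewrite sin_shift, cos_2a_sin.
  pose proof sin_opp_PI_10 as sin_PI_10; rewrite sin_neg in sin_PI_10.
  pose proof beta_sqr.
  replace alpha with (1 - beta) by (unfold alpha, beta; field).
  nra.
Qed.

Lemma is_series_coeff_powerRZ (m : nat) (t : R) (s : Z) :
  (1 <= m)%nat -> - (PI / 2) < t < PI / 2 -> 2 * sin t <> 0 ->
  is_series
    (fun n => coeff m (S n) * powerRZ (2 * sin t) (2 * Z.of_nat (S n) + s))
    (t ^ (2 * m) / INR (fact (2 * m)) * powerRZ (2 * sin t) s).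
Proof.
  intros m_ge_1 t_inside two_sin_neq_0.
  apply (is_series_ext (fun n =>
    coeff m (S n) * (2 * sin t) ^ (2 * S n) * powerRZ (2 * sin t) s)).
  - intros n; rewrite powerRZ_add, pow_powerRZ, Nat2Z.inj_mul by easy.
    apply Rmult_assoc.
  - now apply is_series_scal_r, is_series_coeff_sin.
Qed.

Lemma is_series_coeff_binet_form (m : nat) (p q : R) (s : Z) : (1 <= m)%nat ->
  is_series (fun n => coeff m (S n) * binet_form p q (2 * Z.of_nat (S n) + s))
    (1 / INR (fact (2 * m)) * (PI / 10) ^ (2 * m)
      * binet_form (3 ^ (2 * m) * p) q s).
Proof.
  intros m_ge_1; pose proof PI_RGT_0.
  pose proof (is_series_coeff_powerRZ m (3 * (PI / 10)) s m_ge_1 ltac:(lra))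
    as series_alpha.
  pose proof (is_series_coeff_powerRZ m (- (PI / 10)) s m_ge_1 ltac:(lra))
    as series_beta.
  rewrite sin_3_PI_10 in series_alpha; specialize (series_alpha alpha_neq_0).
  rewrite sin_opp_PI_10 in series_beta; specialize (series_beta beta_neq_0).
  pose proof (is_series_plus _ _ _ _
    (is_series_scal_r p _ _ series_alpha) (is_series_scal_r q _ _ series_beta))
    as series_sum.
  replace (1 / _ * _ * _) with (plus
    ((3 * (PI / 10)) ^ (2 * m) / INR (fact (2 * m)) * powerRZ alpha s * p)
    ((- (PI / 10)) ^ (2 * m) / INR (fact (2 * m)) * powerRZ beta s * q)).
  - revert series_sum; apply is_series_ext; intros n.
    unfold binet_form, plus; simpl; ring.
  - rewrite (pow_mult (- _)), <- (Rsqr_pow2 (- _)), <- Rsqr_neg, Rsqr_pow2.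
    rewrite <- pow_mult, Rpow_mult_distr; unfold binet_form, plus; cbn -[pow].
    field; apply INR_fact_neq_0.
Qed.

Theorem theorem6 (s : Z) (m : nat) (hm : (1 <= m)%nat) :
  is_series
    (fun n : nat => coeff m (S n) * IZR (fibZ (2 * Z.of_nat (S n) + s)))
    (1 / INR (fact (2 * m)) * (PI / 10) ^ (2 * m) * (1 / sqrt 5)
      * ((3 ^ (2 * m) + 1) * powerRZ alpha s - IZR (lucZ s)))
  /\
  is_series
    (fun n : nat => coeff m (S n) * IZR (lucZ (2 * Z.of_nat (S n) + s)))
    (1 / INR (fact (2 * m)) * (PI / 10) ^ (2 * m)
      * ((3 ^ (2 * m) - 1) * powerRZ alpha s + IZR (lucZ s))).
Proof.
  assert (sqrt 5 <> 0) as sqrt5_neq_0 by (pose proof sqrt5_gt_1; lra).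
  pose proof (INR_fact_neq_0 (2 * m)) as fact_neq_0.
  rewrite lucZ_binet; split.
  - replace (_ * _ * _ * _) with (1 / INR (fact (2 * m)) * (PI / 10) ^ (2 * m)
      * binet_form (3 ^ (2 * m) * / sqrt 5) (- / sqrt 5) s)
      by (unfold binet_form; now field).
    eapply is_series_ext; [|now apply is_series_coeff_binet_form].
    intros n; now rewrite fibZ_binet.
  - replace (_ * (_ + _)) with (1 / INR (fact (2 * m)) * (PI / 10) ^ (2 * m)
      * binet_form (3 ^ (2 * m) * 1) 1 s)
      by (unfold binet_form; now field).
    eapply is_series_ext; [|now apply is_series_coeff_binet_form].
    intros n; now rewrite lucZ_binet.
Qed.
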